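(* Let $I\subseteq\mathbb{R}$ be an open interval and let $p,q,\bar q:I\to\mathbb{R}$ be functions. Let $f:I\to\mathbb{R}$ be given by $f(x)=\exp\left(\int p(x)\,dx\right)$, where $\int p(x)\,dx$ denotes an antiderivative of $p$ on $I$ (assumed to exist). Let $y,h:I\to\mathbb{R}$ be twice differentiable solutions on $I$ of the two conjugate equations $$y''(x)+p(x)y'(x)+q(x)y(x)=0,\qquad h''(x)+p(x)h'(x)+\bar q(x)h(x)=0 .$$ Then $$\int f(x)\left(q(x)-\bar q(x)\right)h(x)y(x)\,dx=f(x)\left(h'(x)y(x)-h(x)y'(x)\right).$$
   Context: Two equations of the form $y''+p\,y'+q\,y=0$ are called conjugate if they have the same coefficient $p$ but different coefficients $q$. An indefinite integral identity $\int F(x)\,dx=G(x)$ means that $G$ is differentiable on the interval under consideration with $G'(x)=F(x)$ there (constants of integration are suppressed). *)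

(* Defs.v *)
From Stdlib Require Import Reals.
From Coquelicot Require Import Coquelicot.
Open Scope R_scope.

(* Endpoints are extended reals, so half-lines and the whole line are included. *)
Definition Rbar_open_interval (a b : Rbar) (x : R) : Prop :=
  Rbar_lt a x /\ Rbar_lt x b.

(* Functions on I are represented by total functions.  For an open I, [is_derive],
   [ex_derive] and [Derive] at a point of I depend only on the values on I. *)

(* [antiderivative_on I F G] reads: int F(x) dx = G(x) on I. *)
Definition antiderivative_on (I : R -> Prop) (F G : R -> R) : Prop :=
  forall x : R, I x -> is_derive G x (F x).

Definition twice_differentiable_on (I : R -> Prop) (y : R -> R) : Prop :=
  forall x : R, I x -> ex_derive y x /\ ex_derive (Derive y) x.

(* y is a twice differentiable solution on I of y'' + p y' + q y = 0. *)
Definition solution_on (I : R -> Prop) (p q y : R -> R) : Prop :=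
  twice_differentiable_on I y /\
  forall x : R, I x ->
    Derive (Derive y) x + p x * Derive y x + q x * y x = 0.

(* The equations y'' + p1 y' + q1 y = 0 and y'' + p2 y' + q2 y = 0 are conjugate
   on I: p1 and p2 are equal, q1 and q2 different, as functions on I. *)
Definition conjugate_on (I : R -> Prop) (p1 q1 p2 q2 : R -> R) : Prop :=
  (forall x : R, I x -> p1 x = p2 x) /\
  ~ (forall x : R, I x -> q1 x = q2 x).

(* Main.v *)
Require Import Defs.
From Stdlib Require Import Reals Lra.
From Coquelicot Require Import Coquelicot.
Open Scope R_scope.

(** Let W = h'y - hy' be the Wronskian bracket. Its derivative is h''y - hy'', and eliminating both
    second derivatives through the equations gives W' = -pW + (q - qbar)hy. Since f' = pf, [f] is an
    integrating factor for this first-order linear equation: (fW)' = f(q - qbar)hy.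
    [is_derive_wronskian] supplies W'. *)

Lemma locally_Rbar_open_interval (a b : Rbar) (x : R) :
  Rbar_open_interval a b x -> locally x (Rbar_open_interval a b).
Proof.
  intros Hx.
  exact (open_and _ _ (open_Rbar_gt a) (open_Rbar_lt b) x Hx).
Qed.

(** By the product rule, both products contribute h'y', and these terms cancel in the difference. *)
Lemma is_derive_wronskian (y h : R -> R) (x : R) :
  ex_derive y x -> ex_derive (Derive y) x ->
  ex_derive h x -> ex_derive (Derive h) x ->
  is_derive (fun t => Derive h t * y t - h t * Derive y t) x
    (Derive (Derive h) x * y x - h x * Derive (Derive y) x).
Proof.
  intros dy ddy dh ddh.
  pose proof (is_derive_minus _ _ _ _ _
    (is_derive_mult _ _ _ _ _ (Derive_correct _ _ ddh) (Derive_correct _ _ dy)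
       Rmult_comm)
    (is_derive_mult _ _ _ _ _ (Derive_correct _ _ dh) (Derive_correct _ _ ddy)
       Rmult_comm)) as D.
  replace (Derive (Derive h) x * y x - h x * Derive (Derive y) x) with
    (minus (plus (mult (Derive (Derive h) x) (y x))
                 (mult (Derive h x) (Derive y x)))
           (plus (mult (Derive h x) (Derive y x))
                 (mult (h x) (Derive (Derive y) x)))).
  - exact D.
  - unfold minus, plus, opp, mult; simpl. ring.
Qed.

Theorem mainTheorem2 (a b : Rbar) (p q qbar P f y h : R -> R)
  (Hconj : conjugate_on (Rbar_open_interval a b) p q p qbar)
  (HP : antiderivative_on (Rbar_open_interval a b) p P)
  (Hf : forall x : R, Rbar_open_interval a b x -> f x = exp (P x))
  (Hy : solution_on (Rbar_open_interval a b) p q y)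
  (Hh : solution_on (Rbar_open_interval a b) p qbar h) :
  antiderivative_on (Rbar_open_interval a b)
    (fun x => f x * (q x - qbar x) * h x * y x)
    (fun x => f x * (Derive h x * y x - h x * Derive y x)).
Proof.
  intros x Ix.
  destruct Hy as [Dy Ey], Hh as [Dh Eh].
  destruct (Dy x Ix) as [dy ddy], (Dh x Ix) as [dh ddh].
  assert (Df : is_derive f x (p x * exp (P x))).
  (* [f] is known to equal exp(P) only on the interval; openness makes the equality hold near [x],
     which is enough to transfer the derivative. *)
  { apply (is_derive_ext_loc (fun t => exp (P t))).
    - apply (filter_imp (Rbar_open_interval a b)).
      + intros t It. symmetry. exact (Hf t It).
      + exact (locally_Rbar_open_interval a b x Ix).
    - exact (is_derive_comp exp P x _ _ (is_derive_exp (P x)) (HP x Ix)). }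
  (* This turns the derivative into the integrating-factor relation f' = pf. *)
  rewrite <- (Hf x Ix) in Df.
  assert (yE : Derive (Derive y) x = - (p x * Derive y x + q x * y x))
    by (specialize (Ey x Ix); lra).
  assert (hE : Derive (Derive h) x = - (p x * Derive h x + qbar x * h x))
    by (specialize (Eh x Ix); lra).
  pose proof (is_derive_mult _ _ _ _ _ Df
    (is_derive_wronskian y h x dy ddy dh ddh) Rmult_comm) as D.
  rewrite yE, hE in D.
  (* The right side is f'W + fW' as the product rule yields it; pfW from the first summand cancels
     the -pfW inside the second. *)
  replace (f x * (q x - qbar x) * h x * y x) with
    (plus (mult (p x * f x) (Derive h x * y x - h x * Derive y x))
      (mult (f x) (- (p x * Derive h x + qbar x * h x) * y x
        - h x * - (p x * Derive y x + q x * y x)))).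
  - exact D.
  - unfold plus, mult; simpl. ring.
Qed.
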